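(* For all integers $n$ and $\overline{R}$ with $1\le\overline{R}\le n$, $$K^+(n,n-\overline{R})\le \left(\frac{2n}{\overline{R}}\right)^{\left\lceil \overline{R}^2/(2n-\overline{R})\right\rceil}.$$
   Context: $Q_n=\{0,1\}^n$ is ordered by $x\preceq y$ iff $x_i\le y_i$ for all $i$, and $d(x,y)$ is the Hamming distance. The downward directed ball is $B_n^-(x,R)=\{y\in Q_n: y\preceq x,\ d(x,y)\le R\}$. A set $\mathcal{C}\subseteq Q_n$ downward $R$-covers $Q_n$ if $Q_n=\bigcup_{c\in\mathcal{C}}B_n^-(c,R)$. $K^+(n,R)$ denotes the minimum size of a set $\mathcal{C}\subseteq Q_n$ that downward $R$-covers $Q_n$ (in particular $K^+(n,R)=1$ for $R\ge n$). *)

(* Defs.v *)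
From mathcomp Require Import all_boot.

Set Implicit Arguments.
Unset Strict Implicit.
Unset Printing Implicit Defensive.

Notation cube n := {ffun 'I_n -> bool}.

Section Cube.
Variable n : nat.
Implicit Types (x y c : cube n) (C : {set cube n}) (R : nat).

Definition cube_le x y : bool := [forall i, (x i <= y i)%N].

Definition hamming x y : nat := #|[set i | x i != y i]|.

Definition down_ball x R : {set cube n} :=
  [set y | cube_le y x && (hamming x y <= R)%N].

Definition down_covers R C : bool :=
  [set: cube n] == \bigcup_(c in C) down_ball c R.

Lemma down_coversT R : down_covers R [set: cube n].
Proof.
rewrite /down_covers eq_sym -subTset; apply/subsetP => x _.
apply/bigcupP; exists x; rewrite // inE; apply/andP; split.
  by apply/forallP => i.
rewrite /hamming (_ : [set i | _] = set0) ?cards0 //.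
by apply/setP => i; rewrite !inE eqxx.
Qed.

End Cube.

(* The minimum is over a nonempty family: the whole cube is always a covering
   ([down_coversT]), so the default value of [arg min] is itself admissible. *)
Definition Kplus (n R : nat) : nat :=
  #|[arg min_(C < [set: cube n] | down_covers R C) #|C|]|.

Lemma KplusP n R :
  (exists2 C : {set cube n}, down_covers R C & #|C| = Kplus n R) /\
  (forall C : {set cube n}, down_covers R C -> (Kplus n R <= #|C|)%N).
Proof.
rewrite /Kplus; case: arg_minnP => [|C covC minC]; first exact: down_coversT.
by split; first exists C.
Qed.

(* Main.v *)
Require Import Defs.
From mathcomp Require Import all_boot all_order all_algebra.
From mathcomp Require Import zify ring lra.
Import Order.TTheory GRing.Theory Num.Theory.

(* Passing to complements, one needs a family of subsets [W] of an [n]-set such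
   that every [Y] is missed by some [W] with [#|W| + #|Y| >= r]. Disjoint sets of
   sizes 1, ..., k together with the empty set do this for r = k with k + 1 sets
   on k (k + 1) / 2 points, and such blocks can be juxtaposed: [n] and [r] add up
   while the sizes of the families multiply. With t the ceiling in the exponent,
   write r = t q + e and use t - e blocks with k = q and e blocks with k = q + 1;
   by AM-GM the product is at most (1 + r / t)^t <= (2 n / r)^t. When r is not
   divisible by t, this may take up to d = floor (e (t - e) / (2 t)) points too
   many. Each excess point is removed by exchanging a pair of blocks k = q + 1 for
   a block with one point less and (k + 1)^2 + 1 words instead of (k + 1)^2. The
   d factors 1 + 1 / (k + 1)^2 that this costs are absorbed by the second-order
   gain in AM-GM. *)

(** * Set families in place of codes, and their products *)

(* [F] is the family of complements of the codewords: the codeword with complement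
   [W] covers the point with support [Y] within distance [n - r] exactly when
   [W] misses [Y] and [r <= #|W| + #|Y|]. *)
Definition packs (n r N : nat) : Prop :=
  exists2 F : seq {set 'I_n}, size F <= N &
    forall Y : {set 'I_n}, exists2 W, W \in F & [disjoint W & Y] && (r <= #|W| + #|Y|).

Lemma Kplus_packs n r N : packs n r N -> Kplus n (n - r) <= N.
Proof.
case=> F sizeF coverF; have [_ minK] := KplusP n (n - r).
pose word (W : {set 'I_n}) : cube n := [ffun i => i \notin W].
apply: leq_trans (minK [set c | c \in map word F] _) _; last first.
  by rewrite cardsE (leq_trans (card_size _)) // size_map.
rewrite /down_covers eq_sym -subTset; apply/subsetP => x _.
have [W WF /andP[disjW leW]] := coverF [set i | x i].
apply/bigcupP; exists (word W); first by rewrite inE map_f.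
rewrite inE; apply/andP; split.
  apply/forallP => i; rewrite ffunE; case xi: (x i) => //.
  by rewrite (disjointFl disjW) // inE.
(* The codeword and [x] differ exactly outside [W] and the support of [x]. *)
rewrite /hamming (_ : [set i | _] = ~: (W :|: [set i | x i])); last first.
  apply/setP => i; rewrite !inE ffunE; case xi: (x i); case: (boolP (i \in W)) => //.
  by rewrite (disjointFl disjW) // inE.
rewrite cardsCs setCK card_ord cardsU (disjoint_setI0 disjW) cards0 subn0.
exact: leq_sub2l.
Qed.

(** The sets move along an injection into ['I_n]; points of [Y] outside its image only increase
    [#|Y|]. *)
Lemma packs_finType (T : finType) n r N (F : seq {set T}) :
    #|T| <= n -> size F <= N ->
    (forall Y : {set T}, exists2 W, W \in F & [disjoint W & Y] && (r <= #|W| + #|Y|)) ->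
  packs n r N.
Proof.
move=> leT sizeF coverF; pose f (x : T) := widen_ord leT (enum_rank x).
have f_inj : injective f by move=> x y /(congr1 val)/= /ord_inj /enum_rank_inj.
exists [seq f @: W | W : {set T} <- F]; first by rewrite size_map.
move=> Y; have [W WF /andP[disjW leW]] := coverF (f @^-1: Y).
exists (f @: W); first exact: map_f.
rewrite card_imset //; apply/andP; split.
  apply/pred0P => y /=; apply/negP => /andP[/imsetP[x xW ->] fxY].
  by move/pred0P/(_ x): disjW; rewrite /= xW inE fxY.
apply: leq_trans leW _; rewrite leq_add2l -(card_imset _ f_inj) subset_leq_card //.
by apply/subsetP => _ /imsetP[x + ->]; rewrite inE.
Qed.

Lemma packs_leq n n' r N : n <= n' -> packs n r N -> packs n' r N.
Proof. by move=> len [F sizeF]; apply: packs_finType; rewrite ?card_ord. Qed.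

Lemma packsW n r N N' : N <= N' -> packs n r N -> packs n r N'.
Proof. by move=> leN [F sizeF]; exists F => //; apply: leq_trans leN. Qed.

Definition sum_set {S T : finType} (A : {set S}) (B : {set T}) : {set S + T} :=
  [set x | match x with inl a => a \in A | inr b => b \in B end].

Lemma card_sum_set {S T : finType} (A : {set S}) (B : {set T}) :
  #|sum_set A B| = #|A| + #|B|.
Proof.
rewrite -!sum1_card big_sumType.
by congr (_ + _); apply: eq_bigl => x; rewrite inE.
Qed.

Lemma sum_set_split {S T : finType} (Y : {set S + T}) :
  sum_set (inl @^-1: Y) (inr @^-1: Y) = Y.
Proof. by apply/setP => -[x|x]; rewrite !inE. Qed.

Lemma disjoint_sum_set {S T : finType} (A A' : {set S}) (B B' : {set T}) :
  [disjoint sum_set A B & sum_set A' B'] = [disjoint A & A'] && [disjoint B & B'].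
Proof.
apply/pred0P/andP => [dis|[/pred0P disA /pred0P disB] [x|x]]; last 2 first.
- by rewrite /= !inE; apply: disA.
- by rewrite /= !inE; apply: disB.
by split; apply/pred0P => x; [have := dis (inl x) | have := dis (inr x)]; rewrite /= !inE.
Qed.

Lemma packs_add n1 r1 N1 n2 r2 N2 :
  packs n1 r1 N1 -> packs n2 r2 N2 -> packs (n1 + n2) (r1 + r2) (N1 * N2).
Proof.
move=> [F1 size1 cover1] [F2 size2 cover2].
apply: (@packs_finType ('I_n1 + 'I_n2)%type _ _ _
          [seq sum_set W1 W2 | W1 <- F1, W2 <- F2]).
- by rewrite card_sum !card_ord.
- by rewrite size_allpairs leq_mul.
move=> Y; rewrite -(sum_set_split Y).
have [W1 F1W1 /andP[dis1 le1]] := cover1 (inl @^-1: Y).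
have [W2 F2W2 /andP[dis2 le2]] := cover2 (inr @^-1: Y).
exists (sum_set W1 W2); first exact: allpairs_f.
by rewrite disjoint_sum_set dis1 dis2 !card_sum_set addnACA leq_add.
Qed.

Lemma packs0 : packs 0 0 1.
Proof.
exists [:: set0] => // Y; exists set0; rewrite ?inE //.
by rewrite disjoints_subset sub0set.
Qed.

Lemma packs_exp m n r N : packs n r N -> packs (m * n) (m * r) (N ^ m).
Proof.
move=> packsN; elim: m => [|m IHm]; first by rewrite !mul0n; exact: packs0.
by rewrite !mulSn expnS; apply: packs_add.
Qed.

(** * Chains of disjoint parts *)

Section Chain.
Context {k : nat} (s : 'I_k -> nat).

(** Tagging makes the parts disjoint; the sizes [s] stay general so that a part can be shortened. *)
Definition chain_type : finType := {i : 'I_k & 'I_(s i)}.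

Lemma card_chain_type : #|chain_type| = \sum_(i < k) s i.
Proof. by rewrite card_tagged sumnE big_map big_enum; apply: eq_bigr => i _; rewrite card_ord. Qed.

Definition part (i : 'I_k) : {set chain_type} := [set x | tag x == i].

Lemma card_part i : #|part i| = s i.
Proof.
transitivity (\sum_(j | j == i) \sum_(x < s j) 1).
  rewrite (sig_big_dep (pred1 i) (fun _ => xpredT) (fun _ _ => 1)) -sum1_card.
  by apply: eq_bigl => x; rewrite inE andbT.
by rewrite big_pred1_eq sum1_card card_ord.
Qed.

Definition chain := set0 :: codom part.

Lemma size_chain : size chain = k.+1.
Proof. by rewrite /= size_codom card_ord. Qed.

(* If every part meets [Y], take the empty word. Otherwise take the last part
   [i] missing [Y]: each of the [k - i.+1] later parts contributes a point to [Y]. *)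
Lemma chain_cover (Y : {set chain_type}) :
    (forall i : 'I_k, k <= i.+1 + #|Y| -> k <= s i + #|Y|) ->
  exists2 W, W \in chain & [disjoint W & Y] && (k <= #|W| + #|Y|).
Proof.
move=> large.
have hits (A : {set 'I_k}) : {in A, forall i, ~~ [disjoint part i & Y]} -> #|A| <= #|Y|.
  move=> hitA; rewrite (leq_trans _ (leq_imset_card (fun x : chain_type => tag x) _)) //.
  apply/subset_leq_card/subsetP => i /hitA/pred0Pn[x /andP[]].
  by rewrite /= inE => /eqP <- xY; apply: imset_f.
case: (pickP (fun i => [disjoint part i & Y])) => [i0 dis0 | hit]; last first.
  exists set0; first by rewrite inE eqxx.
  rewrite disjoints_subset sub0set cards0 -[leqLHS]card_ord -cardsT.
  by apply: hits => i _; rewrite hit.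
case: (@arg_maxnP _ i0 (fun i => [disjoint part i & Y]) val dis0) => i disi maxi.
exists (part i); first by rewrite inE codom_f orbT.
rewrite disi card_part; apply: large.
have later : i.+1 + #|[set j : 'I_k | i < j]| = k.
  have -> : [set j : 'I_k | i < j] = ~: [set j : 'I_k | j < i.+1].
    by apply/setP => j; rewrite !inE -leqNgt.
  rewrite cardsCs setCK card_ord -sum1_card.
  under eq_bigl do rewrite inE.
  by rewrite (big_ord_narrow (ltn_ord i)) sum1_card card_ord subnKC.
rewrite -[leqLHS]later leq_add2l; apply: hits => j; rewrite inE ltnNge => /negP lt_ij.
by apply/negP => disj; apply: lt_ij; apply: maxi.
Qed.

End Chain.

Lemma packs_chain k : packs 'C(k.+1, 2) k k.+1.
Proof.
apply: (@packs_finType _ _ _ _ (chain (fun i : 'I_k => i.+1))).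
- by rewrite card_chain_type -triangular_sum big_mkord big_ord_recl.
- by rewrite size_chain.
by move=> Y; apply: chain_cover.
Qed.

Lemma mul2_bin2 n : 2 * 'C(n.+1, 2) = n * n.+1.
Proof. by rewrite mul2n bin2 -[RHS]odd_double_half oddM andbN mulnC. Qed.

(** * Pairs of chains with one point saved *)

(* In the first of two chains the last part loses a point, so that its words
   fail only when [Y] misses the chain altogether; then the whole chain is a
   word that serves both chains at once. *)
Lemma packs_pair_large m : 3 <= m -> packs (m.+1 * m.+2).-1 (2 * m.+1) (m.+2 ^ 2).+1.
Proof.
move=> m_ge3; set k := m.+1.
have [F2 size2 cover2] := packs_chain k.
pose s (i : 'I_k) := minn i.+1 m.
have card_s : #|chain_type s| = 'C(m.+1, 2) + m.
  rewrite card_chain_type big_ord_recr /= {2}/s /= (minn_idPr (leqnSn m)).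
  rewrite -triangular_sum big_mkord big_ord_recl add0n; congr (_ + _).
  by apply: eq_bigr => i _; apply/minn_idPl; exact: ltn_ord i.
apply: (@packs_finType (chain_type s + 'I_('C(k.+1, 2)))%type _ _ _
          (sum_set setT set0 :: [seq sum_set W1 W2 | W1 <- chain s, W2 <- F2])).
- rewrite card_sum card_ord card_s /k.
  by have := mul2_bin2 m; have := mul2_bin2 m.+1; lia.
- by rewrite -cat1s size_cat add1n ltnS size_allpairs size_chain -mulnn leq_mul.
move=> Y; rewrite -(sum_set_split Y).
have [Y1_0 | Y1_gt0] := posnP #|inl @^-1: Y|.
  exists (sum_set setT set0); first exact: mem_head.
  rewrite disjoint_sum_set !card_sum_set (cards0_eq Y1_0) cards0 cardsT card_s.
  rewrite disjoint_sym !disjoints_subset !sub0set /=.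
  (* The shortened chain alone must have at least [2 * k] points, which requires [3 <= m]. *)
  have le_m : 2 * m + 4 <= m * m.+1 by nia.
  by rewrite -mul2_bin2 in le_m; rewrite /k; lia.
have [|W1 FW1 /andP[dis1 le1]] := @chain_cover _ s (inl @^-1: Y).
  move=> i; move: Y1_gt0; rewrite /s /k.
  by set y := #|_|; lia.
have [W2 FW2 /andP[dis2 le2]] := cover2 (inr @^-1: Y).
exists (sum_set W1 W2); first by rewrite inE allpairs_f ?orbT.
by rewrite disjoint_sum_set dis1 dis2 !card_sum_set addnACA mul2n -addnn leq_add.
Qed.

(* Little-endian binary digits, so that words can be listed as numbers. *)
Fixpoint bits n m : bitseq := if n is n'.+1 then odd m :: bits n' m./2 else [::].

Lemma size_bits n m : size (bits n m) = n.
Proof. by elim: n m => //= n IHn m; rewrite IHn. Qed.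

(** Structural recursion lets [vm_compute] decide the quantifier over all words. *)
Fixpoint all_bitseq n (P : pred bitseq) : bool :=
  if n is n'.+1 then all_bitseq n' (fun b => P (true :: b)) && all_bitseq n' (fun b => P (false :: b))
  else P [::].

Lemma all_bitseqP n (P : pred bitseq) b : all_bitseq n P -> size b = n -> P b.
Proof.
elim: n P b => [|n IHn] P [|x b] //= /andP[PT PF] [sizeb].
by case: x; [apply: (IHn (fun b => P (true :: b))) | apply: (IHn (fun b => P (false :: b)))].
Qed.

Definition covers_bits n r (ms : seq nat) : bool :=
  all_bitseq n (fun y => has (fun w =>
    all (fun p => ~~ (p.1 && p.2)) (zip w y) && (r <= count id w + count id y)) (map (bits n) ms)).

Lemma packs_bits n r ms : covers_bits n r ms -> packs n r (size ms).
Proof.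
move=> cov; pose set_of (w : bitseq) : {set 'I_n} := [set i : 'I_n | nth false w i].
pose bits_of (A : {set 'I_n}) := [seq i \in A | i <- enum 'I_n].
have count_bits A : count id (bits_of A) = #|A|.
  by rewrite count_map cardE enumT size_filter.
have set_ofK w : size w = n -> bits_of (set_of w) = w.
  move=> sizew; apply: (@eq_from_nth _ false); rewrite size_map size_enum_ord // => i lt_in.
  by rewrite (nth_map (Ordinal lt_in)) ?size_enum_ord // inE nth_enum_ord.
exists [seq set_of w | w <- map (bits n) ms]; first by rewrite !size_map.
move=> Y.
have size_Y : size (bits_of Y) = n by rewrite size_map size_enum_ord.
have /hasP[w wms /andP[dis le]] := all_bitseqP _ _ _ cov size_Y.
have w_K : bits_of (set_of w) = w by case/mapP: wms => m _ ->; rewrite set_ofK ?size_bits.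
exists (set_of w); first exact: map_f.
rewrite -!count_bits w_K le andbT -setI_eq0; apply/eqP/setP => i; rewrite !inE.
apply/negP => /andP[wi Yi].
have /allP/(_ (true, true)) := dis; rewrite -w_K zip_map => /(_ _)/negP; apply=> //.
by apply/mapP; exists i; rewrite ?mem_enum // inE wi Yi.
Qed.

(* The words of the next two lemmas were found by computer search. *)
Lemma packs_5_4 : packs 5 4 10.
Proof. by apply: (@packs_bits _ _ [:: 0; 1; 6; 10; 11; 12; 16; 17; 22; 29]); vm_compute. Qed.

Lemma packs_11_6 : packs 11 6 17.
Proof.
(* Fourteen words suffice; 17 = 4^2 + 1 is the count [packs_pair] allows for [k = 3]. *)
apply: packsW (isT : 14 <= 17) _.
by apply: (@packs_bits _ _
  [:: 0; 20; 97; 131; 226; 258; 384; 512; 694; 792; 1032; 1292; 1353; 1556]); vm_compute.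
Qed.

(** For [k] equal to 2 or 3 a shortened chain is too small to serve both chains, hence the explicit
    words. *)
Lemma packs_pair k : 2 <= k -> packs (k * k.+1).-1 (2 * k) (k.+1 ^ 2).+1.
Proof.
case: k => [|[|[|[|k]]]] // _; [exact: packs_5_4 | exact: packs_11_6 |].
exact: packs_pair_large.
Qed.

(** * Juxtaposed blocks and their points *)

Lemma packs_mixed t q e d :
    0 < q -> e <= t -> 2 * d <= e ->
  packs ((t - e) * 'C(q.+1, 2) + ((e - 2 * d) * 'C(q.+2, 2) + d * (q.+1 * q.+2).-1))
        (t * q + e) (q.+1 ^ (t - e) * (q.+2 ^ (e - 2 * d) * (q.+2 ^ 2).+1 ^ d)).
Proof.
move=> q_gt0 le_et le_de.
have -> : t * q + e = (t - e) * q + ((e - 2 * d) * q.+1 + d * (2 * q.+1)).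
  have eq_e := subnK le_de; have eq_t := subnK le_et.
  set e' := e - 2 * d in eq_e *; set f := t - e in eq_t *.
  by rewrite -eq_t -[in LHS]eq_e; ring.
by do !apply: packs_add; apply: packs_exp; do ?exact: packs_chain; exact: packs_pair.
Qed.

(** Without savings the blocks have (r^2 + t r + e (t - e)) / (2 t) points. As r^2 + t r <= 2 t n,
    the excess over [n] is at most the floor [d]. *)
Lemma mixed_points n r t q e d :
    r = t * q + e -> e <= t -> 0 < t -> r <= n -> r ^ 2 <= t * (2 * n - r) ->
    d = (e * (t - e)) %/ (2 * t) -> 2 * d <= e ->
  (t - e) * 'C(q.+1, 2) + ((e - 2 * d) * 'C(q.+2, 2) + d * (q.+1 * q.+2).-1) <= n.
Proof.
move=> def_r le_et t_gt0 le_rn le_r2 def_d le_de.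
have [bq bq1] := (mul2_bin2 q, mul2_bin2 q.+1).
have lt_d : e * (t - e) < (2 * t) * d.+1.
  by rewrite def_d [ltnRHS]mulnC ltn_ceil // muln_gt0.
set P := (X in X <= n).
have P2 : 2 * (P + d) = (t - e) * (q * q.+1) + e * (q.+1 * q.+2).
  have split_d : d * (q.+1 * q.+2).-1 + d = d * (q.+1 * q.+2) by rewrite -mulnSr prednK.
  have eq_e := subnK le_de; rewrite /P; set e' := e - 2 * d in eq_e *.
  rewrite -!addnA split_d -bq -bq1 -eq_e; ring.
have eq_t := subnK le_et; set f := t - e in eq_t lt_d P2.
have P2t : 2 * t * (P + d) = r ^ 2 + t * r + e * f.
  rewrite (_ : 2 * t * (P + d) = t * (2 * (P + d))); last by ring.
  by rewrite P2 def_r -eq_t; ring.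
have le_t : r ^ 2 + t * r <= 2 * t * n.
  have le_r2n : r <= 2 * n by rewrite mul2n -addnn (leq_trans le_rn) ?leq_addl.
  apply: leq_trans (leq_add le_r2 (leqnn _)) _.
  by rewrite -mulnDr subnK // mulnA (mulnC t).
have : 2 * t * (P + d) < 2 * t * (n + d.+1).
  by rewrite P2t mulnDr -addnS leq_add.
by rewrite ltn_mul2l addnS ltnS leq_add2r => /andP[].
Qed.

(** * Log-concavity and a sharpened AM-GM *)

Local Open Scope ring_scope.

(** Once a log-concave sequence drops from at least 1 to below 1, it never increases again, so its
    last term would be below 1. *)
Lemma log_concave_ge1 (R : realFieldType) (t : nat) (u : nat -> R) :
    (forall i, 0 < u i) -> 1 <= u 0 -> 1 <= u t ->
    (forall i, (i.+1 < t)%N -> u i * u i.+2 <= u i.+1 ^+ 2) ->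
  forall i, (i <= t)%N -> 1 <= u i.
Proof.
move=> u_gt0 u0 ut conc; elim=> [//|i IHi] lt_it; rewrite leNgt; apply/negP => u_lt1.
(* The second conjunct carries the descent through the induction on [t], which starts at [i.+1]. *)
suff [] : u t < 1 /\ u t <= u t.-1 by rewrite ltNge ut.
have ui := IHi (ltnW lt_it).
elim: t lt_it {ut IHi} conc => // t IHt; rewrite leq_eqVlt => /predU1P[[<-]|lt_it] conc.
  by split=> //=; rewrite (le_trans (ltW u_lt1)).
have [j lt_jt|ut le_ut] := IHt lt_it; first by apply: conc; apply: ltnW.
have le_uSt : u t.+1 <= u t; last by split; rewrite //= (le_lt_trans le_uSt).
case: t lt_it {IHt} conc ut le_ut => // t lt_it conc ut le_ut.
rewrite -(ler_pM2l (u_gt0 t)) (le_trans (conc t _)) // expr2.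
by rewrite ler_pM2r.
Qed.

(** Dividing [u i ^+ t] by the geometric progression with the same end values leaves a log-concave
    sequence equal to 1 at both ends. *)
Lemma log_concave_interp (R : realFieldType) (t : nat) (u : nat -> R) :
    (forall i, 0 < u i) ->
    (forall i, (i.+1 < t)%N -> u i * u i.+2 <= u i.+1 ^+ 2) ->
  forall i, (i <= t)%N -> u 0 ^+ (t - i) * u t ^+ i <= u i ^+ t.
Proof.
move=> u_gt0 conc i le_it.
pose z := u t / u 0; pose v i := u i ^+ t / (u 0 ^+ t * z ^+ i).
have z_gt0 : 0 < z by rewrite divr_gt0.
have w_gt0 j : 0 < u 0 ^+ t * z ^+ j by rewrite mulr_gt0 ?exprn_gt0.
have u0_neq0 : u 0 != 0 by rewrite gt_eqF.
have : 1 <= v i.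
  apply: (@log_concave_ge1 _ t) => // [j||| j lt_jt].
  - by rewrite divr_gt0 ?exprn_gt0.
  - by rewrite /v expr0 mulr1 divff // gt_eqF ?exprn_gt0.
  - by rewrite /v -exprMn /z [u 0 * _]mulrC divfK // divff // gt_eqF ?exprn_gt0.
  rewrite /v mulf_div -exprMn [leRHS]expr_div_n exprAC.
  have -> : u 0 ^+ t * z ^+ j * (u 0 ^+ t * z ^+ j.+2) = (u 0 ^+ t * z ^+ j.+1) ^+ 2.
    by rewrite !exprS; ring.
  rewrite ler_pM2r ?invr_gt0 ?exprn_gt0 //.
  by rewrite lerXn2r ?nnegrE ?exprn_ge0 ?mulr_ge0 ?(ltW (u_gt0 _)) ?conc.
rewrite /v ler_pdivlMr // mul1r; apply: le_trans; rewrite le_eqVlt; apply/orP; left.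
apply/eqP; rewrite /z expr_div_n -[X in u 0 ^+ X * (_ / _)](subnK le_it) exprD.
by rewrite -mulrA; congr (_ * _); rewrite mulrCA divff ?mulr1 // expf_neq0.
Qed.

(* Weighted AM-GM for [t - e] copies of [a] and [e] copies of [a.+1]. As log'' is
   at most [- 1 / a.+1^2] between them, the logarithm of the mean gains at least
   [e (t - e) / (2 t^2 a.+1^2)]. Here this is obtained from the log-concavity of
   [u i], the square of [t * a + i] times a discrete Gaussian factor that uses up
   the concavity. *)
Lemma amgm_gain (R : realFieldType) (t e d a : nat) :
    (0 < a)%N -> (0 < t)%N -> (e <= t)%N -> (2 * t * d <= e * (t - e))%N ->
  a%:R ^+ (t - e) * a.+1%:R ^+ e * (1 + (a.+1%:R ^+ 2)^-1) ^+ d * t%:R ^+ t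
    <= (t * a + e)%:R ^+ t :> R.
Proof.
move=> a_gt0 t_gt0 le_et le_d; set M : R := a.+1%:R.
have M_gt0 : 0 < M by rewrite ltr0n.
have t_gt0R : 0 < t%:R :> R by rewrite ltr0n.
have a_gt0R : 0 < a%:R :> R by rewrite ltr0n.
pose x := (t%:R * M) ^- 2.
have x_gt0 : 0 < x by rewrite invr_gt0 exprn_gt0 ?mulr_gt0.
pose sigma := 1 + x; have sigma_gt0 : 0 < sigma by rewrite addr_gt0.
pose m i : R := (t * a + i)%:R.
have m_gt0 i : 0 < m i by rewrite ltr0n addn_gt0 muln_gt0 t_gt0 a_gt0.
pose u i := m i ^+ 2 * sigma ^+ (i ^ 2).
have u_gt0 i : 0 < u i by rewrite mulr_gt0 ?exprn_gt0.
have u_conc i : (i.+1 < t)%N -> u i * u i.+2 <= u i.+1 ^+ 2.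
  move=> lt_it.
  have -> : u i * u i.+2 = (m i * m i.+2 * sigma) ^+ 2 * sigma ^+ (2 * i.+1 ^ 2).
    have pow_sigma : sigma ^+ (i ^ 2) * sigma ^+ (i.+2 ^ 2) = sigma ^+ 2 * sigma ^+ (2 * i.+1 ^ 2).
      by rewrite -!exprD; congr (_ ^+ _); lia.
    by rewrite /u mulrACA pow_sigma !exprMn !mulrA.
  have -> : u i.+1 ^+ 2 = (m i.+1 ^+ 2) ^+ 2 * sigma ^+ (2 * i.+1 ^ 2).
    by rewrite /u exprMn (mulnC 2) [in RHS]exprM.
  have m_ge0 j : 0 <= m j by apply: ltW.
  rewrite ler_pM2r ?exprn_gt0 // lerXn2r ?nnegrE ?mulr_ge0 ?exprn_ge0 ?(ltW sigma_gt0) //.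
  (* With m = [m i.+1] at most [t * M], m^2 x <= 1 gives (m^2 - 1) (1 + x) <= m^2. *)
  have -> : m i = m i.+1 - 1 by rewrite /m addnS mulrS addrAC subrr add0r.
  have -> : m i.+2 = m i.+1 + 1 by rewrite /m addnS mulrS addrC.
  have le_m : m i.+1 <= t%:R * M by rewrite /m /M -natrM ler_nat; nia.
  have le1 : m i.+1 ^+ 2 * x <= 1.
    rewrite ler_pdivrMr ?exprn_gt0 ?mulr_gt0 // mul1r.
    by rewrite lerXn2r ?nnegrE ?m_ge0 // ltW // mulr_gt0.
  by rewrite /sigma; lra.
have := @log_concave_interp _ t u u_gt0 u_conc e le_et.
have -> : u 0 = (t%:R * a%:R) ^+ 2 by rewrite /u /m mulr1 addn0 natrM.
have -> : u t = (t%:R * M) ^+ 2 * sigma ^+ (t ^ 2) by rewrite /u /m -mulnSr natrM.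
(* Bernoulli bounds 1 + 1 / M^2 = 1 + t^2 x by [sigma ^+ (t ^ 2)]; the exponents then compare by [t]
   times [le_d]. *)
have bern : (1 + M ^- 2) ^+ (2 * d) * sigma ^+ (t * e ^ 2) <= sigma ^+ (t ^ 2 * e).
  have : 1 + M ^- 2 <= sigma ^+ (t ^ 2).
    have -> : M ^- 2 = x *+ (t ^ 2).
      rewrite -mulr_natr natrX /x exprMn [(_ * M ^+ 2)^-1]invfM mulrAC mulVf ?mul1r //.
      by rewrite expf_neq0 // gt_eqF.
    have x_ge0 : 0 <= x by apply: ltW.
    elim: (t ^ 2)%N => [|N IHN]; first by rewrite expr0 addr0.
    rewrite exprS mulrS -(ler_pM2l sigma_gt0) in IHN *; apply: le_trans IHN.
    have : 0 <= x *+ N by rewrite mulrn_wge0.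
    by rewrite /sigma; nra.
  move=> le_c; apply: le_trans (_ : sigma ^+ (t ^ 2 * (2 * d)) * sigma ^+ (t * e ^ 2) <= _).
    rewrite ler_pM2r ?exprn_gt0 // [leRHS]exprM lerXn2r ?nnegrE ?exprn_ge0 ?(ltW sigma_gt0) //.
    by rewrite addr_ge0 // invr_ge0 exprn_ge0 // ltW.
  rewrite -exprD ler_weXn2l ?lerDl ?(ltW x_gt0) //.
  have -> : (t ^ 2 * (2 * d) + t * e ^ 2 = t * (2 * t * d + e * e))%N by ring.
  have -> : (t ^ 2 * e = t * (e * t))%N by ring.
  have le_ee : (e * e <= e * t)%N by rewrite leq_mul2l le_et orbT.
  by rewrite leq_mul2l; apply/orP; right; rewrite mulnBr in le_d; lia.
move=> main; have c_gt0 : 0 < 1 + M ^- 2 by rewrite addr_gt0 // invr_gt0 exprn_gt0.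
(* Squaring and multiplying by the Gaussian factor turns the right side into [u e ^+ t]. *)
rewrite -(ler_pXn2r (isT : (0 < 2)%N)) ?nnegrE ?mulr_ge0 ?exprn_ge0 ?(ltW c_gt0) ?ler0n //.
rewrite -(@ler_pM2r _ (sigma ^+ (t * e ^ 2))) ?exprn_gt0 //.
have -> : (t * a + e)%:R ^+ t ^+ 2 * sigma ^+ (t * e ^ 2) = u e ^+ t.
  by rewrite /u exprMn exprAC [(t * e ^ 2)%N]mulnC exprM.
apply: le_trans main; pose b : R := a%:R ^+ (t - e) * M ^+ e * t%:R ^+ t.
have -> : (a%:R ^+ (t - e) * M ^+ e * (1 + M ^- 2) ^+ d * t%:R ^+ t) ^+ 2 * sigma ^+ (t * e ^ 2)
   = b ^+ 2 * ((1 + M ^- 2) ^+ (2 * d) * sigma ^+ (t * e ^ 2)).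
  by rewrite [(2 * d)%N]mulnC [_ ^+ (d * 2)]exprM /b; ring.
have -> : (t%:R * a%:R) ^+ 2 ^+ (t - e) * ((t%:R * M) ^+ 2 * sigma ^+ (t ^ 2)) ^+ e
   = b ^+ 2 * sigma ^+ (t ^ 2 * e).
  have -> : b = a%:R ^+ (t - e) * M ^+ e * (t%:R ^+ (t - e) * t%:R ^+ e) by rewrite -exprD subnK.
  rewrite [_ ^+ (t ^ 2 * e)]exprM.
  rewrite [(_ * sigma ^+ _) ^+ e]exprMn [_ ^+ 2 ^+ (t - e)]exprAC [_ ^+ 2 ^+ e]exprAC.
  by rewrite [(_ * a%:R) ^+ _]exprMn [(_ * M) ^+ _]exprMn; ring.
by rewrite ler_pM2l ?exprn_gt0 // /b !mulr_gt0 ?exprn_gt0.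
Qed.

(** * Choice of parameters and the final bound *)

Theorem theorem14 (n Rbar : nat) (Rbar_ge1 : (1 <= Rbar)%N)
    (Rbar_len : (Rbar <= n)%N) :
  (Kplus n (n - Rbar))%:R <=
    (2 * n%:R / Rbar%:R : rat)
      ^ Num.ceil (Rbar%:R ^+ 2 / (2 * n%:R - Rbar%:R) : rat).
Proof.
set r := Rbar in Rbar_ge1 Rbar_len *; set z : rat := _ / (_ - _).
have den_gt0 : 0 < 2 * n%:R - r%:R :> rat.
  by rewrite subr_gt0 -natrM ltr_nat; lia.
have r_gt0 : 0 < r%:R :> rat by rewrite ltr0n.
have z_gt0 : 0 < z by rewrite divr_gt0 ?exprn_gt0.
have ceil_z : 0 < Num.ceil z by rewrite ceil_gt0.
have [t def_t] : exists t : nat, Num.ceil z = t.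
  by case: (Num.ceil z) ceil_z => // t _; exists t.
have t_gt0 : (0 < t)%N by rewrite def_t in ceil_z.
(* As r <= n, [z] is at most [r]; this makes [q] positive. *)
have le_tr : (t <= r)%N.
  have : Num.ceil z <= r%:Z; last by rewrite def_t.
  rewrite ceil_le_int /z ler_pdivrMr //.
  rewrite expr2 ler_pM2l // lerBrDr -natrD -natrM ler_nat; lia.
have le_r2 : (r ^ 2 <= t * (2 * n - r))%N.
  have : z <= (Num.ceil z)%:~R by rewrite ceil_ge.
  rewrite def_t /z ler_pdivrMr // -natrX -natrM -natrB; last by lia.
  by rewrite -natrM ler_nat.
rewrite def_t; pose q := (r %/ t)%N; pose e := (r %% t)%N.
have def_r : r = (t * q + e)%N by rewrite mulnC -divn_eq.
have le_et : (e <= t)%N by rewrite ltnW // ltn_mod.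
have q_gt0 : (0 < q)%N by rewrite divn_gt0.
pose d := ((e * (t - e)) %/ (2 * t))%N.
have le_td : (2 * t * d <= e * (t - e))%N by rewrite mulnC leq_divM.
have le_de : (2 * d <= e)%N by nia.
have pack_n := packs_leq _ _ _ _ (mixed_points n r t q e d def_r le_et t_gt0 Rbar_len le_r2 erefl le_de)
  (packs_mixed t q e d q_gt0 le_et le_de).
rewrite -def_r in pack_n.
have := Kplus_packs _ _ _ pack_n; rewrite -(ler_nat rat) => /le_trans; apply.
have tR_gt0 : 0 < t%:R :> rat by rewrite ltr0n.
(* The middle term is (1 + r / t)^t, from [amgm_gain] with [a = q.+1]; each pair contributes (q +
   2)^2 (1 + 1 / (q + 2)^2) words. *)
apply: (@le_trans _ _ ((t * q.+1 + e)%:R ^+ t / t%:R ^+ t)).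
  rewrite ler_pdivlMr ?exprn_gt0 //.
  apply: le_trans (amgm_gain rat t e d q.+1 isT t_gt0 le_et le_td).
  rewrite le_eqVlt; apply/orP; left; apply/eqP; congr (_ * _).
  rewrite !natrM !natrX -mulrA; congr (_ * _).
  rewrite -[in RHS](subnK le_de) exprD exprM -mulrA -exprMn.
  congr (_ * _ ^+ _).
  rewrite mulrDr mulr1 divff ?expf_neq0 ?pnatr_eq0 //.
  by rewrite -natrX natr1.
rewrite -expr_div_n -exprnP lerXn2r ?nnegrE ?divr_ge0 ?mulr_ge0 ?ler0n //.
(* What remains, (t + r) r <= 2 n t, is [le_r2] with t r added. *)
rewrite ler_pdivrMr // mulrAC ler_pdivlMr // -!natrM ler_nat.
have -> : (t * q.+1 + e = t + r)%N by rewrite mulnS -addnA -def_r.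
rewrite mulnDl addnC mulnn (leq_trans (leq_add le_r2 (leqnn _))) //.
have le_r2n : (r <= 2 * n)%N by lia.
by rewrite -mulnDr subnK // mulnC.
Qed.
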